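(* Let $\mathcal{A}$ be a unital $C^*$-algebra, $\mathcal{H}$ a complex Hilbert space, $P\in\mathscr{B}(\mathcal{H})$ a positive invertible operator, and $\Phi\in\mathrm{CP}^{(P)}(\mathcal{A},\mathscr{B}(\mathcal{H}))$. Define $\widehat{\Phi}(a):=P^{-1/2}\Phi(a)P^{-1/2}$ for $a\in\mathcal{A}$. Then the following are equivalent: (i) $\Phi$ is a $P$-$C^*$-extreme point of $\mathrm{CP}^{(P)}(\mathcal{A},\mathscr{B}(\mathcal{H}))$; (ii) $\widehat{\Phi}$ is a $C^*$-extreme point of $\mathrm{UCP}(\mathcal{A},\mathscr{B}(\mathcal{H}))$; (iii) $\Phi=\mathrm{Ad}_T\circ\widetilde{\Psi}$ for some $C^*$-extreme point $\widetilde{\Psi}$ of $\mathrm{UCP}(\mathcal{A},\mathscr{B}(\mathcal{H}))$ and some invertible $T\in\mathscr{B}(\mathcal{H})$ with $T^*T=P$; (iv) for every completely positive map $\Psi:\mathcal{A}\to\mathscr{B}(\mathcal{H})$ with $\Psi\leq_{cp}\Phi$ and $\Psi(1)$ invertible, there exists an invertible operator $Z\in\mathscr{B}(\mathcal{H})$ such that $\Psi=\mathrm{Ad}_Z\circ\Phi$.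
   Context: $\mathscr{B}(\mathcal{H})$ is the algebra of bounded linear operators on $\mathcal{H}$; $1$ is the unit of $\mathcal{A}$, $I$ the identity operator. ''CP'' means completely positive (linear). For $T\in\mathscr{B}(\mathcal{H})$, $\mathrm{Ad}_T(X):=T^*XT$. For CP maps $\Psi,\Phi$, $\Psi\leq_{cp}\Phi$ means that $\Phi-\Psi$ is CP. $\mathrm{UCP}(\mathcal{A},\mathscr{B}(\mathcal{H}))$ is the set of unital CP maps $\mathcal{A}\to\mathscr{B}(\mathcal{H})$. For a positive operator $P$, $\mathrm{CP}^{(P)}(\mathcal{A},\mathscr{B}(\mathcal{H}))$ is the set of all CP maps $\Phi:\mathcal{A}\to\mathscr{B}(\mathcal{H})$ with $\Phi(1)=P$. A map $\Phi\in\mathrm{CP}^{(P)}(\mathcal{A},\mathscr{B}(\mathcal{H}))$ is a $P$-$C^*$-extreme point of this set if whenever $\Phi=\sum_{j=1}^n\mathrm{Ad}_{T_j}\circ\Phi_j$ with $n\ge 1$, $\Phi_j\in\mathrm{CP}^{(P)}(\mathcal{A},\mathscr{B}(\mathcal{H}))$ and $T_j\in\mathscr{B}(\mathcal{H})$ invertible with $\sum_{j=1}^nT_j^*PT_j=P$, there exist invertible $S_j\in\mathscr{B}(\mathcal{H})$ such that $\Phi_j=\mathrm{Ad}_{S_j}\circ\Phi$ for all $1\leq j\leq n$. A map $\Phi\in\mathrm{UCP}(\mathcal{A},\mathscr{B}(\mathcal{H}))$ is a $C^*$-extreme point of $\mathrm{UCP}(\mathcal{A},\mathscr{B}(\mathcal{H}))$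 if whenever $\Phi=\sum_{j=1}^n\mathrm{Ad}_{T_j}\circ\Phi_j$ with $\Phi_j\in\mathrm{UCP}(\mathcal{A},\mathscr{B}(\mathcal{H}))$ and $T_j$ invertible with $\sum_{j=1}^nT_j^*T_j=I$, there exist unitaries $U_j\in\mathscr{B}(\mathcal{H})$ with $\Phi_j=\mathrm{Ad}_{U_j}\circ\Phi$ for all $j$. *)

(* Defs.v *)
From HB Require Import structures.
From mathcomp Require Import all_boot all_order all_algebra.
From mathcomp Require Import complex.
From mathcomp Require Import all_classical all_reals all_analysis.

Set Implicit Arguments.
Unset Strict Implicit.
Unset Printing Implicit Defensive.

Import Order.TTheory GRing.Theory Num.Theory.
Import numFieldNormedType.Exports.

Local Open Scope classical_set_scope.
Local Open Scope ring_scope.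

(** Complex Hilbert spaces. The form [dotp] is linear in its first argument and
    conjugate-linear in the second; norms take their values in [R[i]]. *)
HB.mixin Record CompleteNormedModule_isHilbert (R : realType) H
    & CompleteNormedModule R[i] H := {
  dotp : {dot H for (@Num.conj R[i])} ;
  dotp_norm : forall x : H, dotp x x = `|x| ^+ 2
}.

#[short(type="hilbertType")]
HB.structure Definition Hilbert (R : realType) :=
  {H of CompleteNormedModule R[i] H & CompleteNormedModule_isHilbert R H}.

(** Unital C*-algebras; the zero algebra is not excluded. The product is part of
    the mixin, and the ring structure is derived from it below, because Hierarchy
    Builder cannot join the library's rings with its normed modules: such a join
    would have to be declared before [Num.NumDomain]. *)
HB.mixin Record CompleteNormedModule_isCStarAlgebra (R : realType) A
    & CompleteNormedModule R[i] A := {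
  cstar_mul : A -> A -> A ;
  cstar_one : A ;
  cstar_mulA : associative cstar_mul ;
  cstar_mul1l : left_id cstar_one cstar_mul ;
  cstar_mul1r : right_id cstar_one cstar_mul ;
  cstar_mulDl : left_distributive cstar_mul +%R ;
  cstar_mulDr : right_distributive cstar_mul +%R ;
  cstar_scaleAl : forall (k : R[i]) (a b : A),
    k *: cstar_mul a b = cstar_mul (k *: a) b ;
  cstar_scaleAr : forall (k : R[i]) (a b : A),
    k *: cstar_mul a b = cstar_mul a (k *: b) ;
  cstar_normM : forall a b : A, `|cstar_mul a b| <= `|a| * `|b| ;
  star : A -> A ;
  starD : forall a b : A, star (a + b) = star a + star b ;
  starZ : forall (k : R[i]) (a : A), star (k *: a) = Num.conj k *: star a ;
  starM : forall a b : A, star (cstar_mul a b) = cstar_mul (star b) (star a) ;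
  starK : forall a : A, star (star a) = a ;
  cstar_norm : forall a : A, `|cstar_mul (star a) a| = `|a| ^+ 2
}.

#[short(type="cstarAlgType")]
HB.structure Definition CStarAlgebra (R : realType) :=
  {A of CompleteNormedModule R[i] A & CompleteNormedModule_isCStarAlgebra R A}.

#[non_forgetful_inheritance]
HB.instance Definition _ (R : realType) (A : cstarAlgType R) :=
  GRing.Zmodule_isPzRing.Build A (@cstar_mulA R A) (@cstar_mul1l R A)
    (@cstar_mul1r R A) (@cstar_mulDl R A) (@cstar_mulDr R A).

(** The algebra of bounded linear operators on [H]. *)
Definition bounded_op (R : realType) (H : hilbertType R) (f : H -> H) : Prop :=
  linear f /\ exists M : R[i], forall x, `|f x| <= M * `|x|.

Record bop (R : realType) (H : hilbertType R) : Type :=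
  Bop { bop_fun :> H -> H ; bopP : bounded_op bop_fun }.

Section BopRing.
Variables (R : realType) (H : hilbertType R).
Implicit Types S T U : bop H.

Lemma bop_eq S T : S =1 T -> S = T.
Proof.
case: S T => [f fP] [g gP] /= /funext fg; case: _ / fg in gP *.
by rewrite (Prop_irrelevance fP gP).
Qed.

HB.instance Definition _ := gen_eqMixin (bop H).
HB.instance Definition _ := gen_choiceMixin (bop H).

Let zero_boundedP : bounded_op (fun _ : H => 0).
Proof.
split; first by move=> k x y; rewrite scaler0 addr0.
by exists 0 => x; rewrite normr0 mul0r.
Qed.

Let id_boundedP : bounded_op (fun x : H => x).
Proof. by split=> //; exists 1 => x; rewrite mul1r. Qed.

Let add_boundedP S T : bounded_op (fun x => S x + T x).
Proof.
case: (bopP S) (bopP T) => [Sl [M SM]] [Tl [N TN]]; split.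
  by move=> k x y; rewrite Sl Tl scalerDr addrACA.
by exists (M + N) => x; rewrite mulrDl (le_trans (ler_normD _ _))// lerD.
Qed.

Let scale_boundedP (k : R[i]) T : bounded_op (fun x => k *: T x).
Proof.
case: (bopP T) => [Tl [N TN]]; split.
  by move=> l x y; rewrite Tl scalerDr !scalerA mulrC.
by exists (`|k| * N) => x; rewrite normrZ -mulrA ler_wpM2l.
Qed.

Let comp_boundedP S T : bounded_op (fun x => S (T x)).
Proof.
case: (bopP S) (bopP T) => [Sl [M SM]] [Tl [N TN]]; split.
  by move=> k x y; rewrite Tl Sl.
exists (`|M| * N) => x; rewrite (le_trans (SM _))//.
rewrite -mulrA (@le_trans _ _ (`|M| * `|T x|))//; last by rewrite ler_wpM2l.
have [->|Tx0] := eqVneq `|T x| 0; first by rewrite !mulr0.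
have Tx_gt0 : 0 < `|T x| by rewrite lt_def Tx0 normr_ge0.
have : 0 <= M * `|T x| by apply: le_trans (SM _).
by rewrite pmulr_lge0// => M0; rewrite ger0_norm.
Qed.

Definition bop_zero := Bop zero_boundedP.
Definition bop_one := Bop id_boundedP.
Definition bop_add S T := Bop (add_boundedP S T).
Definition bop_scale k T := Bop (scale_boundedP k T).
Definition bop_opp T := bop_scale (-1) T.
Definition bop_comp S T := Bop (comp_boundedP S T).

Lemma bop_linear T : linear T. Proof. by case: (bopP T). Qed.

Lemma bop_funD T x y : T (x + y) = T x + T y.
Proof. by have := bop_linear T 1 x y; rewrite !scale1r. Qed.

Let addA : associative bop_add.
Proof. by move=> S T U; apply: bop_eq => x /=; rewrite addrA. Qed.
Let addC : commutative bop_add.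
Proof. by move=> S T; apply: bop_eq => x /=; rewrite addrC. Qed.
Let add0 : left_id bop_zero bop_add.
Proof. by move=> T; apply: bop_eq => x /=; rewrite add0r. Qed.
Let addN : left_inverse bop_zero bop_opp bop_add.
Proof. by move=> T; apply: bop_eq => x /=; rewrite scaleN1r addNr. Qed.

HB.instance Definition _ := GRing.isZmodule.Build (bop H) addA addC add0 addN.

Let scaleA (k l : R[i]) T : bop_scale k (bop_scale l T) = bop_scale (k * l) T.
Proof. by apply: bop_eq => x /=; rewrite scalerA. Qed.
Let scale1 : left_id 1 bop_scale.
Proof. by move=> T; apply: bop_eq => x /=; rewrite scale1r. Qed.
Let scaleDr : right_distributive bop_scale +%R.
Proof. by move=> k S T; apply: bop_eq => x /=; rewrite scalerDr. Qed.
Let scaleDl T : {morph bop_scale^~ T : k l / k + l >-> k + l}.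
Proof. by move=> k l; apply: bop_eq => x /=; rewrite scalerDl. Qed.

HB.instance Definition _ := GRing.Zmodule_isLmodule.Build R[i] (bop H)
  scaleA scale1 scaleDr scaleDl.

Let compA : associative bop_comp. Proof. by move=> S T U; apply: bop_eq. Qed.
Let comp1l : left_id bop_one bop_comp. Proof. by move=> T; apply: bop_eq. Qed.
Let comp1r : right_id bop_one bop_comp. Proof. by move=> T; apply: bop_eq. Qed.
Let compDl : left_distributive bop_comp +%R.
Proof. by move=> S T U; apply: bop_eq. Qed.
Let compDr : right_distributive bop_comp +%R.
Proof. by move=> S T U; apply: bop_eq => x /=; rewrite bop_funD. Qed.

HB.instance Definition _ := GRing.Zmodule_isPzRing.Build (bop H)
  compA comp1l comp1r compDl compDr.

End BopRing.

Section Operators.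
Variables (R : realType) (H : hilbertType R).
Implicit Types S T U P X : bop H.

(** The adjoint, the inverse and the positive square root are the unique
    operators with the stated property; the default value [0] is only taken
    when there is no such operator, which never happens for the adjoint
    (Riesz representation) and the square root of a positive operator. *)
Definition adjoint T : bop H :=
  xget 0 [set S : bop H | forall x y : H, dotp (T x) y = dotp x (S y)].

Definition invertible T : Prop := exists S : bop H, S * T = 1 /\ T * S = 1.

Definition op_inv T : bop H := xget 0 [set S : bop H | S * T = 1 /\ T * S = 1].

Definition positive T : Prop := forall x : H, 0 <= dotp (T x) x.

Definition op_sqrt P : bop H := xget 0 [set S : bop H | positive S /\ S * S = P].

Definition unitary U : Prop := adjoint U * U = 1 /\ U * adjoint U = 1.

Definition Ad T X : bop H := adjoint T * X * T.

End Operators.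

Section CompletelyPositive.
Variables (R : realType) (A : cstarAlgType R) (H : hilbertType R).
Implicit Types (Phi Psi : A -> bop H) (P : bop H).

(** Positive elements of the C*-algebra M_n(A). *)
Definition mx_positive n (X : 'M[A]_n) : Prop :=
  exists Y : 'M[A]_n, X = (map_mx (@star R A) Y)^T *m Y.

(** Positivity of an n x n matrix of operators, acting on H^n. *)
Definition opmx_positive n (X : 'I_n -> 'I_n -> bop H) : Prop :=
  forall x : 'I_n -> H, 0 <= \sum_i dotp (\sum_j X i j (x j)) (x i).

Definition completely_positive Phi : Prop :=
  linear Phi /\
  forall n (X : 'M[A]_n), mx_positive X -> opmx_positive (fun i j => Phi (X i j)).

Definition cp_le Psi Phi : Prop := completely_positive (fun a => Phi a - Psi a).

Definition CP P : set (A -> bop H) :=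
  [set Phi | completely_positive Phi /\ Phi 1 = P].

Definition UCP : set (A -> bop H) := CP 1.

Definition P_Cstar_extreme P Phi : Prop :=
  CP P Phi /\
  forall (n : nat) (Phi_ : 'I_n -> A -> bop H) (T : 'I_n -> bop H),
    (0 < n)%N ->
    (forall j, CP P (Phi_ j)) ->
    (forall j, invertible (T j)) ->
    \sum_j adjoint (T j) * P * T j = P ->
    (forall a, Phi a = \sum_j Ad (T j) (Phi_ j a)) ->
    forall j, exists S : bop H, invertible S /\ Phi_ j = Ad S \o Phi.

Definition Cstar_extreme Phi : Prop :=
  UCP Phi /\
  forall (n : nat) (Phi_ : 'I_n -> A -> bop H) (T : 'I_n -> bop H),
    (0 < n)%N ->
    (forall j, UCP (Phi_ j)) ->
    (forall j, invertible (T j)) ->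
    \sum_j adjoint (T j) * T j = 1 ->
    (forall a, Phi a = \sum_j Ad (T j) (Phi_ j a)) ->
    forall j, exists U : bop H, unitary U /\ Phi_ j = Ad U \o Phi.

(** P^(-1/2) Phi(a) P^(-1/2), for [P] positive and invertible. *)
Definition hat P Phi (a : A) : bop H :=
  op_inv (op_sqrt P) * Phi a * op_inv (op_sqrt P).

End CompletelyPositive.

(* Main.v *)
Require Import Defs.
From mathcomp Require Import all_boot all_order all_algebra.
From mathcomp Require Import complex.
From mathcomp Require Import all_classical all_reals all_analysis.
From mathcomp Require Import ring lra.
Import Order.TTheory GRing.Theory Num.Theory.
Import numFieldNormedType.Exports.
Local Open Scope classical_set_scope.
Local Open Scope ring_scope.
Set Implicit Arguments.
Unset Strict Implicit.
Unset Printing Implicit Defensive.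

(** If [P^(1/2) Phij P^(1/2) = Ad Z o Phi] with [Phij] unital and [Z] invertible, then
    [P^(1/2) Z P^(-1/2)] is an invertible isometry, hence a unitary: this gives
    (i) => (ii). For (ii) => (iii) take [T = P^(1/2)].
    For (iii) => (iv) one may assume that [Phi] is unital. If [Psi <= Phi] and
    [Q = Psi 1] is invertible, then [Phi = Psi / 2 + (Phi - Psi / 2)], where the two
    summands have the invertible values [Q / 2] and [1 - Q / 2] at [1]; normalised by
    the square roots of these values, they form a proper C*-convex combination, so
    [Psi] is a conjugate of [Phi]. For (iv) => (i), the summands [Ad Tj o Phij] of
    [Phi] lie below [Phi] and take the invertible values [Tj^* P Tj] at [1].

    The adjoint comes from the Riesz representation theorem. Inverses of [1 - B] and
    square roots of positive invertible operators are fixed points of contractions of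
    a ball of operators. *)

(** * The underlying real inner product space of a complex Hilbert space *)

Section RealGeometry.
Local Open Scope complex_scope.
Variables (R : realType) (H : hilbertType R).
Implicit Types (x y z : H) (t : R) (k : R[i]).

(** Taking real parts moves all estimates into the ordered field [R]; [eq_dotp] recovers the complex
    form. *)
Definition ip x y : R := complex.Re (dotp x y).

Definition hnorm x : R := complex.Re `|x|.

Lemma dotpDl x y z : dotp (x + y) z = dotp x z + dotp y z.
Proof. exact: linearDl. Qed.

Lemma dotpDr x y z : dotp x (y + z) = dotp x y + dotp x z.
Proof. exact: linearD. Qed.

Lemma dotpZl k x y : dotp (k *: x) y = k * dotp x y.
Proof. exact: linearZl_LR. Qed.

Lemma dotpZr k x y : dotp x (k *: y) = Num.conj k * dotp x y.
Proof. exact: linearZr_LR. Qed.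

Lemma dotpC x y : dotp x y = Num.conj (dotp y x).
Proof. by rewrite (hermitian_subproof (s := @dotp R H)) /= mul1r. Qed.

Lemma dotp0l x : dotp 0 x = 0. Proof. exact: linear0l. Qed.

Lemma dotpNl x y : dotp (- x) y = - dotp x y. Proof. exact: linearNl. Qed.

Lemma dotpNr x y : dotp x (- y) = - dotp x y. Proof. exact: linearN. Qed.

Lemma ReD (a b : R[i]) : complex.Re (a + b) = complex.Re a + complex.Re b.
Proof. by case: a b => ? ? [? ?]. Qed.

Lemma ReN (a : R[i]) : complex.Re (- a) = - complex.Re a.
Proof. by case: a. Qed.

Lemma Re_real t (a : R[i]) : complex.Re (t%:C * a) = t * complex.Re a.
Proof. by case: a => a b /=; rewrite mul0r subr0. Qed.

Lemma Re_i (a : R[i]) : complex.Re ('i * a) = - complex.Im a.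
Proof. by case: a => a b /=; rewrite mul0r mul1r sub0r. Qed.

Lemma conjE (a : R[i]) : Num.conj a = conjc a.
Proof. exact: erefl. Qed.

Lemma ipDl x y z : ip (x + y) z = ip x z + ip y z.
Proof. by rewrite /ip dotpDl ReD. Qed.

Lemma ipDr x y z : ip x (y + z) = ip x y + ip x z.
Proof. by rewrite /ip dotpDr ReD. Qed.

Lemma ipNl x y : ip (- x) y = - ip x y.
Proof. by rewrite /ip dotpNl ReN. Qed.

Lemma ipNr x y : ip x (- y) = - ip x y.
Proof. by rewrite /ip dotpNr ReN. Qed.

Lemma ipZl t x y : ip (t%:C *: x) y = t * ip x y.
Proof. by rewrite /ip dotpZl Re_real. Qed.

Lemma ipC x y : ip x y = ip y x.
Proof. by rewrite /ip dotpC conjE; case: (dotp y x). Qed.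

Lemma ipZr t x y : ip x (t%:C *: y) = t * ip x y.
Proof. by rewrite ipC ipZl ipC. Qed.

Lemma normE x : `|x| = (hnorm x)%:C.
Proof. by rewrite /hnorm RRe_real// ger0_real. Qed.

Lemma hnorm_ge0 x : 0 <= hnorm x.
Proof. by rewrite -ler0c -normE. Qed.

Lemma hnormD x y : hnorm (x + y) <= hnorm x + hnorm y.
Proof. by rewrite -lecR rmorphD/= -!normE ler_normD. Qed.

Lemma hnormN x : hnorm (- x) = hnorm x.
Proof. by rewrite /hnorm normrN. Qed.

Lemma hnorm0 : hnorm (0 : H) = 0.
Proof. by rewrite /hnorm normr0. Qed.

Lemma hnorm0_eq0 x : hnorm x = 0 -> x = 0.
Proof. by move=> x0; apply: normr0_eq0; rewrite normE x0. Qed.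

Lemma norm_real t : `|t%:C| = `|t|%:C.
Proof. by rewrite normc_def /= expr0n addr0 sqrtr_sqr. Qed.

Lemma hnormZ k x : hnorm (k *: x) = complex.Re `|k| * hnorm x.
Proof.
by rewrite /hnorm normrZ -Re_real RRe_real.
Qed.

Lemma hnorm_real t x : hnorm (t%:C *: x) = `|t| * hnorm x.
Proof. by rewrite hnormZ norm_real. Qed.

Lemma ipxx x : ip x x = hnorm x ^+ 2.
Proof. by rewrite /ip dotp_norm normE -rmorphXn. Qed.

(** Cauchy-Schwarz comes from the triangle inequality: expand the square of [hnorm (x + y)] and
    compare it with the square of [hnorm x + hnorm y]. *)
Lemma ip_le x y : ip x y <= hnorm x * hnorm y.
Proof.
have h := hnorm_ge0 (x + y).
have := hnormD x y.
have: hnorm (x + y) ^+ 2 = hnorm x ^+ 2 + 2 * ip x y + hnorm y ^+ 2.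
  by rewrite -!ipxx ipDl !ipDr (ipC y x); ring.
by nra.
Qed.

Lemma norm_ip_le x y : `|ip x y| <= hnorm x * hnorm y.
Proof. by rewrite ler_norml ip_le lerNl -ipNl -(hnormN x) ip_le. Qed.

(** The choice [k = 1] compares real parts, and [k = 'i] compares imaginary parts. *)
Lemma eq_dotp x y x' y' :
    (forall k, ip (k *: x) y = ip (k *: x') y') -> dotp x y = dotp x' y'.
Proof.
move=> e; apply/eqP; rewrite eq_complex; apply/andP; split; apply/eqP.
  by have := e 1; rewrite !scale1r.
by have := e 'i; rewrite /ip !dotpZl !Re_i => /oppr_inj.
Qed.

Lemma hnorm_complete (u : nat -> H) :
  (forall e, 0 < e -> exists N, forall n, (N <= n)%N -> hnorm (u N - u n) < e) ->
  exists l, forall e, 0 < e -> exists N, forall n, (N <= n)%N -> hnorm (l - u n) < e.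
Proof.
move=> cu.
have /cauchy_cvg : cauchy (u @ \oo).
  apply/cauchy_exP => e e0; have : 0 < complex.Re e by move: e0; rewrite ltcE => /andP[].
  move=> /cu[N uN]; exists (u N); exists N => //= n Nn.
  rewrite -ball_normE/= normE [ltRHS](_ : _ = (complex.Re e)%:C) ?ltcR ?uN//.
  by rewrite RRe_real// gtr0_real.
move=> /cvg_ex[l ul]; exists l => e e0.
have /cvg_ballP/(_ e%:C) := ul; rewrite ltcR => /(_ e0)[N _ uN].
by exists N => n /uN /=; rewrite -ball_normE/= normE ltcR.
Qed.

End RealGeometry.

(** * Sequences with geometric decay *)

Section Geometric.
Local Open Scope complex_scope.
Variable R : realType.

Lemma geometric_small (K q e : R) : 0 <= q < 1 -> 0 < e ->
  exists N, forall n, (N <= n)%N -> K * q ^+ n < e.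
Proof.
move=> /andP[q0 q1] e0.
have : (geometric K q @ \oo) --> (0:R).
  by apply: cvg_geometric; rewrite ger0_norm.
move=> /cvgrPdist_lt/(_ _ e0)[N _ hN]; exists N => n /hN /=.
by rewrite sub0r normrN; apply: le_lt_trans; rewrite ler_norm.
Qed.

(** The form in which limits are taken below: an equality follows once the distance between its
    sides is at most [K * q ^+ n] for every [n]. *)
Lemma geometric_le0 (K q a : R) : 0 <= q < 1 ->
  (forall n, a <= K * q ^+ n) -> a <= 0.
Proof.
move=> q01 aK; rewrite leNgt; apply/negP => /(geometric_small K q01)[N].
by move=> /(_ N (leqnn _)); rewrite ltNge aK.
Qed.

Variable H : hilbertType R.

Lemma geometric_cvg (u : nat -> H) (K q : R) : 0 <= q < 1 ->
    (forall n, hnorm (u n.+1 - u n) <= K * q ^+ n) ->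
  exists l, forall n, hnorm (l - u n) <= K / (1 - q) * q ^+ n.
Proof.
move=> q01 uK; have [q0 q1] := andP q01.
have K0 : 0 <= K by have := uK 0%N; rewrite expr0 mulr1; apply/le_trans/hnorm_ge0.
set L := K / (1 - q).
have L0 : 0 <= L by rewrite divr_ge0// subr_ge0 ltW.
have KE : K = L * (1 - q) by rewrite divfK// subr_eq0 gt_eqF.
(* The terms [K q^i] with [n <= i < n + m] sum exactly to the right-hand side, since
   [K = L (1 - q)]. *)
have dist n m : hnorm (u n - u (n + m)%N) <= L * q ^+ n - L * q ^+ (n + m).
  elim: m => [|m IH]; first by rewrite addn0 !subrr hnorm0.
  have -> : u n - u (n + m.+1)%N = (u n - u (n + m)%N) - (u (n + m).+1 - u (n + m)%N).
    by rewrite addnS opprB addrA subrK.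
  apply: (le_trans (hnormD _ _)); rewrite hnormN.
  have := uK (n + m)%N; rewrite addnS exprS KE => h.
  by rewrite (le_trans (lerD IH h))// le_eqVlt; apply/orP; left; apply/eqP; ring.
have dist' n m : (n <= m)%N -> hnorm (u n - u m) <= L * q ^+ n.
  move=> /subnKC <-; apply: le_trans (dist _ _) _.
  by rewrite gerBl mulr_ge0 ?exprn_ge0.
have [l ul] : exists l, forall e, 0 < e ->
    exists N, forall n, (N <= n)%N -> hnorm (l - u n) < e.
  apply: hnorm_complete => e e0; have [N hN] := geometric_small L q01 e0.
  by exists N => n Nn; apply: le_lt_trans (dist' _ _ Nn) _; apply: hN.
exists l => n; apply/ler_addgt0Pr => e e0; have [N hN] := ul _ e0.
have -> : l - u n = (l - u (maxn n N)) - (u n - u (maxn n N)).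
  by rewrite opprB addrA subrK.
apply: le_trans (hnormD _ _) _; rewrite hnormN addrC lerD ?dist' ?leq_maxl//.
by rewrite ltW// hN// leq_maxr.
Qed.

End Geometric.

(** * Riesz representation and adjoints *)

Section Adjoint.
Local Open Scope complex_scope.
Variables (R : realType) (H : hilbertType R).
Implicit Types (x y z : H) (S T U : bop H) (t M : R) (k : R[i]).

(** A minimiser of [|x|^2 - 2 f x] represents [f]: a minimising sequence is
    Cauchy by the parallelogram identity. *)
Lemma riesz (f : H -> R) M :
    (forall t x y, f (t%:C *: x + y) = t * f x + f y) ->
    (forall x, `|f x| <= M * hnorm x) ->
  exists z, forall x, ip x z = f x.
Proof.
move=> flin fM; pose J x := hnorm x ^+ 2 - 2 * f x.
(* Completing the square: [J x >= (hnorm x - M)^2 - M^2]. *)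
have Jlb x : - M ^+ 2 <= J x.
  have := fM x; rewrite ler_norml => /andP[_ fx]; rewrite /J.
  by have := sqr_ge0 (hnorm x - M); nra.
pose m := inf (range J).
have hi : has_inf (range J).
  by split; [exists (J 0), 0|exists (- M ^+ 2) => _ [x _ <-]].
have Jm x : m <= J x by apply: ge_inf; [exact: hi.2|exists x].
(* The precision [4^-n] for [J] becomes [2^-n] for norms, which enter [J] squared. *)
have /choice[u uJ] : forall n : nat, exists x, J x < m + 4^-1 ^+ n.
  move=> n; have [|_ [x _ <-] xm] := @inf_adherent _ (range J) (4^-1 ^+ n) _ hi.
    by rewrite exprn_gt0.
  by exists x.
have f0 : f 0 = 0 by have := flin (-1) 0 0; rewrite scaler0 addr0; lra.
have fB x y : f (x - y) = f x - f y.
  have := flin (-1) y x; rewrite rmorphN rmorph1 scaleN1r addrC => ->.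
  by rewrite mulN1r addrC.
have J_step n t x : J (t%:C *: x + u n) =
    J (u n) + t ^+ 2 * hnorm x ^+ 2 + 2 * t * (ip x (u n) - f x).
  by rewrite /J -!ipxx flin ipDl !ipDr !ipZl !ipZr (ipC (u n)); ring.
have four n : (2^-1 : R) ^+ n ^+ 2 = 4^-1 ^+ n.
  by rewrite exprAC; congr (_ ^+ _); field.
(* Moving from [u n] along [x] by the optimal step [t = - g / h^2] lowers [J] by [g^2 / h^2], which
   cannot exceed the gap [4^-n] to the infimum. *)
have near n x : `|ip x (u n) - f x| <= hnorm x * 2^-1 ^+ n.
  have [x0|x0] := eqVneq (hnorm x) 0.
    by rewrite (hnorm0_eq0 x0) f0 subr0 hnorm0 mul0r /ip dotp0l normr0.
  set g := ip x (u n) - f x; set h := hnorm x in x0 *.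
  have h0 : 0 < h by rewrite lt_def x0 hnorm_ge0.
  have : g ^+ 2 / h ^+ 2 <= 4^-1 ^+ n.
    have := Jm ((- g / h ^+ 2)%:C *: x + u n); rewrite J_step -/g -/h.
    have -> : J (u n) + (- g / h ^+ 2) ^+ 2 * h ^+ 2 + 2 * (- g / h ^+ 2) * g =
      J (u n) - g ^+ 2 / h ^+ 2 by field.
    by have := uJ n; lra.
  rewrite ler_pdivrMr ?exprn_gt0// mulrC -four -exprMn => gh.
  rewrite -ler_sqr ?nnegrE//.
    by rewrite real_normK ?num_real.
  by rewrite mulr_ge0 ?exprn_ge0// ltW.
have cu n : hnorm (u n.+1 - u n) <= 2 * 2^-1 ^+ n.
  rewrite -ler_sqr ?nnegrE ?hnorm_ge0 ?mulr_ge0 ?exprn_ge0// exprMn four.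
  (* The last argument of [J] is the midpoint of [u n] and [u n.+1], where [J] is at least [m]; the
     linear terms cancel. *)
  have par : hnorm (u n.+1 - u n) ^+ 2 =
      2 * J (u n.+1) + 2 * J (u n) - 4 * J ((2^-1)%:C *: (u n.+1 - u n) + u n).
    by rewrite J_step /J -!ipxx fB !ipDl !ipDr !ipNl !ipNr (ipC (u n)); field.
  have := Jm ((2^-1)%:C *: (u n.+1 - u n) + u n).
  have := uJ n; have := uJ n.+1; rewrite par exprS.
  have : 0 < (4^-1 : R) ^+ n by rewrite exprn_gt0.
  by lra.
have q01 : 0 <= (2^-1 : R) < 1 by lra.
have [z zu] := geometric_cvg q01 cu; exists z => x; apply/eqP.
rewrite -subr_eq0 -normr_le0.
apply: (@geometric_le0 _ (hnorm x + hnorm x * (2 / (1 - 2^-1))) 2^-1) => // n.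
have -> : ip x z - f x = ip x (u n) - f x + ip x (z - u n).
  by rewrite ipDr ipNr; ring.
rewrite (le_trans (ler_normD _ _))// mulrDl lerD//.
by rewrite (le_trans (norm_ip_le _ _))// -mulrA ler_wpM2l ?hnorm_ge0.
Qed.

Lemma dotp_inj u v : (forall x, dotp x u = dotp x v) -> u = v.
Proof.
move=> uv; apply/eqP; rewrite -subr_eq0; apply/eqP/hnorm0_eq0/eqP.
by rewrite -sqrf_eq0 -ipxx /ip dotpDr dotpNr uv subrr.
Qed.

Lemma bop0 T : T 0 = 0.
Proof. by apply: (@addrI _ (T 0)); rewrite -bop_funD !addr0. Qed.

Lemma bopZ T k x : T (k *: x) = k *: T x.
Proof. by have := bop_linear T k x 0; rewrite bop0 !addr0. Qed.

(** The bound in [bounded_op] lies in [R[i]] and is forced to be nonnegative only if [H] has a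
    nonzero vector, hence the modulus; adding [1] makes it positive. *)
Lemma bop_bound T : exists2 M : R, 0 < M & forall x, hnorm (T x) <= M * hnorm x.
Proof.
case: (bopP T) => _ [M TM]; exists (complex.Re `|M| + 1).
  by rewrite ltr_wpDl// -ler0c RRe_real// ger0_real.
move=> x; rewrite mulrDl mul1r ler_wpDr ?hnorm_ge0//.
have [x0|x0] := eqVneq (hnorm x) 0.
  by rewrite (hnorm0_eq0 x0) bop0 hnorm0 mulr0.
have x_gt0 : 0 < `|x| by rewrite normE ltcR lt_def x0 hnorm_ge0.
have M0 : 0 <= M by rewrite -(pmulr_lge0 _ x_gt0) (le_trans _ (TM x)).
have ME : (complex.Re `|M|)%:C = M by rewrite ger0_norm// RRe_real// ger0_real.
by have := TM x; rewrite -[in X in X -> _]ME !normE -rmorphM lecR.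
Qed.

Lemma adjoint_exists T : exists S : bop H, forall x y, dotp (T x) y = dotp x (S y).
Proof.
have [M M0 TM] := bop_bound T.
(* Riesz represents the real part only; since [T] commutes with complex scalars, [eq_dotp] upgrades
   this to the full form. *)
have /choice[S TS] y : exists z, forall x, dotp (T x) y = dotp x z.
  have [||z fz] := @riesz (fun x => ip (T x) y) (M * hnorm y).
  - by move=> t u v; rewrite bop_linear ipDl ipZl.
  - by move=> x; rewrite (le_trans (norm_ip_le _ _))// mulrAC ler_wpM2r ?hnorm_ge0.
  by exists z => x; apply: eq_dotp => k; rewrite -bopZ fz.
suff Sb : bounded_op S by exists (Bop Sb) => x y; apply: TS.
split.
  move=> k u v; apply: dotp_inj => x.
  by rewrite dotpDr dotpZr -!TS dotpDr dotpZr.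
exists M%:C => x; rewrite !normE -rmorphM/= lecR.
(* Cancel one factor [|S x|] in [|S x|^2 = <T (S x), x> <= M |S x| |x|]. *)
have [->|Sx0] := eqVneq (hnorm (S x)) 0; first by rewrite mulr_ge0 ?hnorm_ge0// ltW.
have Sx_gt0 : 0 < hnorm (S x) by rewrite lt_def Sx0 hnorm_ge0.
rewrite -(ler_pM2l Sx_gt0) -expr2 -ipxx /ip -TS (le_trans (ip_le _ _))//.
by rewrite mulrA ler_wpM2r ?hnorm_ge0// mulrC TM.
Qed.

Lemma adjointP T x y : dotp (T x) y = dotp x (adjoint T y).
Proof.
rewrite /adjoint; case: xgetP => [S _ /(_ x y)//|none].
by have [S TS] := adjoint_exists T; have := none S TS.
Qed.

Lemma adjointPr T x y : dotp x (T y) = dotp (adjoint T x) y.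
Proof. by rewrite dotpC adjointP -dotpC. Qed.

Lemma adjoint_unique S T : (forall x y, dotp (T x) y = dotp x (S y)) -> adjoint T = S.
Proof. by move=> TS; apply: bop_eq => y; apply: dotp_inj => x; rewrite -adjointP. Qed.

Lemma adjointK T : adjoint (adjoint T) = T.
Proof. by apply: adjoint_unique => x y; rewrite -adjointPr. Qed.

Lemma adjointM S T : adjoint (S * T) = adjoint T * adjoint S.
Proof. by apply: adjoint_unique => x y /=; rewrite !adjointP. Qed.

Lemma adjointD S T : adjoint (S + T) = adjoint S + adjoint T.
Proof.
by apply: adjoint_unique => x y /=; rewrite dotpDl dotpDr !adjointP.
Qed.

Lemma adjointB S T : adjoint (S - T) = adjoint S - adjoint T.
Proof.
apply: adjoint_unique => x y /=.
by rewrite !scaleN1r dotpDl dotpDr dotpNl dotpNr !adjointP.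
Qed.

Lemma adjointZ t T : adjoint (t%:C *: T) = t%:C *: adjoint T.
Proof.
apply: adjoint_unique => x y /=; rewrite dotpZl dotpZr adjointP conjE.
by rewrite conjc_real.
Qed.

Lemma adjoint1 : adjoint (1 : bop H) = 1.
Proof. exact: adjoint_unique. Qed.

End Adjoint.

(** * Norm bounds of operators and the contraction principle *)

Section OperatorBounds.
Local Open Scope complex_scope.
Variables (R : realType) (H : hilbertType R).
Implicit Types (x y : H) (B C D S T P Q : bop H) (b c t q M N : R).

Definition bounded_by T M := forall x, hnorm (T x) <= M * hnorm x.

Lemma bounded_by0 : bounded_by 0 0.
Proof. by move=> x /=; rewrite hnorm0 mul0r. Qed.

Lemma bounded_by1 : bounded_by 1 1.
Proof. by move=> x /=; rewrite mul1r. Qed.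

Lemma bounded_byW T M N : M <= N -> bounded_by T M -> bounded_by T N.
Proof. by move=> MN TM x; rewrite (le_trans (TM x))// ler_wpM2r// hnorm_ge0. Qed.

Lemma bounded_byD S T M N :
  bounded_by S M -> bounded_by T N -> bounded_by (S + T) (M + N).
Proof. by move=> SM TN x; rewrite mulrDl (le_trans (hnormD _ _))// lerD. Qed.

Lemma bounded_byZ t T M : bounded_by T M -> bounded_by (t%:C *: T) (`|t| * M).
Proof. by move=> TM x; rewrite hnorm_real -mulrA ler_wpM2l. Qed.

Lemma bounded_byN T M : bounded_by T M -> bounded_by (- T) M.
Proof. by move=> TM x /=; rewrite scaleN1r hnormN. Qed.

Lemma bounded_byB S T M N :
  bounded_by S M -> bounded_by T N -> bounded_by (S - T) (M + N).
Proof. by move=> SM /bounded_byN; apply: bounded_byD. Qed.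

Lemma bounded_byM S T M N : 0 <= M ->
  bounded_by S M -> bounded_by T N -> bounded_by (S * T) (M * N).
Proof.
by move=> M0 SM TN x; rewrite (le_trans (SM _))// -mulrA ler_wpM2l.
Qed.

Lemma bounded_by_adjoint T M : bounded_by T M -> bounded_by (adjoint T) M.
Proof.
move=> TM x; have [y0|y0] := eqVneq (hnorm (adjoint T x)) 0.
  have := TM x; have := hnorm_ge0 (T x); rewrite y0; lra.
have y_gt0 : 0 < hnorm (adjoint T x) by rewrite lt_def y0 hnorm_ge0.
rewrite -(ler_pM2l y_gt0) -expr2 -ipxx /ip -adjointP (le_trans (ip_le _ _))//.
by rewrite mulrA ler_wpM2r ?hnorm_ge0// mulrC TM.
Qed.

Lemma bounded_by_geometric T M q : 0 <= q < 1 ->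
  (forall n, bounded_by T (M * q ^+ n)) -> T = 0.
Proof.
move=> q01 TM; apply: bop_eq => x /=; apply/hnorm0_eq0/eqP.
rewrite eq_le hnorm_ge0 andbT.
by apply: (@geometric_le0 _ (M * hnorm x) q) => // n; rewrite mulrAC TM.
Qed.

(** [F] maps the ball of radius [M] into itself and is [q]-Lipschitz there; quantifying over all
    bounds [N] of [C - D] replaces the operator norm. *)
Definition contracts (F : bop H -> bop H) M q :=
  (forall C, bounded_by C M -> bounded_by (F C) M) /\
  forall C D N, bounded_by C M -> bounded_by D M -> 0 <= N ->
    bounded_by (C - D) N -> bounded_by (F C - F D) (q * N).

(** By induction on [n], applying [F] to both points bounds [C - D] by [2 M q^n]. *)
Lemma fixpoint_unique F M q C D : 0 <= M -> 0 <= q < 1 -> contracts F M q ->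
  bounded_by C M -> bounded_by D M -> F C = C -> F D = D -> C = D.
Proof.
move=> M0 q01 [_ Fq] CM DM FC FD; apply/eqP; rewrite -subr_eq0; apply/eqP.
apply: (@bounded_by_geometric _ (M + M) q) => // n; have [q0 _] := andP q01.
elim: n => [|n IH]; first by rewrite mulr1; apply: bounded_byB.
rewrite -{1}FC -{1}FD exprS mulrCA; apply: Fq => //.
by rewrite mulr_ge0 ?addr_ge0 ?exprn_ge0.
Qed.

(** The iterates of [F] from [0] converge at each vector, with an error proportional to [hnorm x].
    The pointwise limit is therefore linear and bounded, and is a limit in operator norm. *)
Lemma fixpoint_exists F M q : 0 <= M -> 0 <= q < 1 -> contracts F M q ->
  exists2 C, bounded_by C M & F C = C.
Proof.
move=> M0 q01 [FM Fq]; have [q0 q1] := andP q01.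
pose u n := iter n F 0.
have uM n : bounded_by (u n) M.
  elim: n => [|n] /=; last exact: FM.
  by apply: bounded_byW M0 _; apply: bounded_by0.
have du n : bounded_by (u n.+1 - u n) (M * q ^+ n).
  elim: n => [|n IH]; first by rewrite subr0 mulr1; apply: uM.
  rewrite exprS mulrCA; apply: (Fq (u n.+1) (u n)) => //.
  by rewrite mulr_ge0 ?exprn_ge0.
set K := M / (1 - q).
have K0 : 0 <= K by rewrite divr_ge0// subr_ge0 ltW.
have /choice[l lu] x : exists l, forall n, hnorm (l - u n x) <= K * hnorm x * q ^+ n.
  have [|l lu] := @geometric_cvg _ _ (fun n => u n x) (M * hnorm x) q q01.
    by move=> n; have := du n x; rewrite /= scaleN1r mulrAC.
  by exists l => n; rewrite /K (mulrAC M).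
have llin : linear l.
  move=> k x y; apply/eqP; rewrite -subr_eq0; apply/eqP/hnorm0_eq0/eqP.
  rewrite eq_le hnorm_ge0 andbT; set a := complex.Re `|k|.
  have a0 : 0 <= a by rewrite -ler0c RRe_real ?ger0_real.
  apply: (@geometric_le0 _ (K * (hnorm (k *: x + y) + a * hnorm x + hnorm y)) q) => // n.
  have -> : l (k *: x + y) - (k *: l x + l y) =
      (l (k *: x + y) - u n (k *: x + y)) + (- (k *: (l x - u n x)) - (l y - u n y)).
    by rewrite bop_linear scalerBr -opprD addrACA -opprD opprB addrA subrK.
  apply: le_trans (hnormD _ _) _; apply: le_trans (lerD (lu _ n) (hnormD _ _)) _.
  rewrite !hnormN hnormZ -/a -addrA mulrDr mulrDl lerD// mulrDr mulrDl lerD//.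
  by rewrite mulrCA -mulrA ler_wpM2l.
have lM x : hnorm (l x) <= M * hnorm x.
  rewrite -subr_le0; apply: (@geometric_le0 _ (K * hnorm x) q) => // n.
  have := lu x n; have := uM n x; have := hnormD (l x - u n x) (u n x).
  by rewrite subrK; lra.
have lb : bounded_op l.
  by split=> //; exists M%:C => x; rewrite !normE -rmorphM lecR.
pose C := Bop lb; have CM : bounded_by C M by [].
have Cu n : bounded_by (C - u n) (K * q ^+ n).
  by move=> x /=; rewrite scaleN1r mulrAC.
exists C => //; apply/eqP; rewrite -subr_eq0; apply/eqP.
apply: (@bounded_by_geometric _ (K + K) q) => // n.
have -> : F C - C = (F C - F (u n)) - (C - u n.+1).
  by rewrite opprB addrA subrK.
have -> : (K + K) * q ^+ n = K * q ^+ n + K * q ^+ n by rewrite mulrDl.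
have qn : 0 <= K * q ^+ n by rewrite mulr_ge0 ?exprn_ge0.
apply: bounded_byB.
  apply: (@bounded_byW _ (q * (K * q ^+ n))); first by nra.
  exact: Fq.
apply: bounded_byW (Cu _); rewrite exprS; nra.
Qed.

End OperatorBounds.

(** * Positive operators, Neumann inverses and square roots *)

Section PositiveOperators.
Local Open Scope complex_scope.
Variables (R : realType) (H : hilbertType R).
Implicit Types (x y : H) (B C D S T P Q : bop H) (b c t q M N : R) (k : R[i]).

Lemma bop_scaleAl k S T : k *: (S * T) = (k *: S) * T.
Proof. exact: bop_eq. Qed.

Lemma bop_scaleAr k S T : k *: (S * T) = S * (k *: T).
Proof. by apply: bop_eq => x /=; rewrite bopZ. Qed.

Lemma invertible_lr S T Q : S * T = 1 -> T * Q = 1 -> invertible T.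
Proof.
move=> ST TQ; exists S; split=> //; suff -> : S = Q by [].
by rewrite -[S]mulr1 -TQ mulrA ST mul1r.
Qed.

Lemma invertibleM S T : invertible S -> invertible T -> invertible (S * T).
Proof.
move=> [S' [S'S SS']] [T' [T'T TT']]; exists (T' * S'); split.
  by rewrite mulrA -(mulrA T') S'S mulr1.
by rewrite mulrA -(mulrA S) TT' mulr1.
Qed.

Lemma invertible_adjoint T : invertible T -> invertible (adjoint T).
Proof.
by move=> [S [ST TS]]; exists (adjoint S); rewrite -!adjointM ST TS adjoint1.
Qed.

Lemma op_invP T : invertible T -> op_inv T * T = 1 /\ T * op_inv T = 1.
Proof.
move=> [S STS]; rewrite /op_inv; case: xgetP => [//|none].
by have := none S STS.
Qed.

Lemma op_invl T : invertible T -> op_inv T * T = 1.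
Proof. by case/op_invP. Qed.

Lemma op_invr T : invertible T -> T * op_inv T = 1.
Proof. by case/op_invP. Qed.

Lemma invertible_inv T : invertible T -> invertible (op_inv T).
Proof. by move=> /op_invP[? ?]; exists T. Qed.

Lemma invertibleZ t T : t != 0 -> invertible T -> invertible (t%:C *: T).
Proof.
move=> t0 [S [ST TS]]; exists (t^-1%:C *: S); rewrite -!bop_scaleAl -!bop_scaleAr.
by rewrite !scalerA -!rmorphM/= mulfV// mulVf// !scale1r.
Qed.

(** In [R[i]] a nonnegative number is real. Reality of the quadratic form at [x], [y] and
    [x + 'i *: y] yields symmetry of [ip (T x) y], that is, self-adjointness. *)
Lemma positiveE T : positive T <-> adjoint T = T /\ forall x, 0 <= ip (T x) x.
Proof.
split=> [T0|[Tsa T0] x]; last first.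
  rewrite lecE T0 andbT; apply/eqP.
  have : dotp (T x) x = conjc (dotp (T x) x) by rewrite {1}adjointP Tsa dotpC.
  by case: (dotp (T x) x) => a b [] /=; lra.
have T0' x : complex.Im (dotp (T x) x) = 0 /\ 0 <= ip (T x) x.
  by have := T0 x; rewrite lecE => /andP[/eqP].
split; last by move=> x; case: (T0' x).
have ipT x y : ip (T x) y = ip x (T y).
  have := (T0' (x + 'i *: y)).1; rewrite bop_funD bopZ !dotpDl !dotpDr !dotpZl !dotpZr.
  rewrite conjE (ipC x) /ip; have := (T0' x).1; have := (T0' y).1.
  case: (dotp (T x) x) (dotp (T y) y) (dotp (T x) y) (dotp (T y) x)
    => [a1 a2] [b1 b2] [c1 c2] [d1 d2] /=.
  by lra.
by apply: adjoint_unique => x y; apply: eq_dotp => k; rewrite -bopZ ipT.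
Qed.

Lemma positive_adjoint T : positive T -> adjoint T = T.
Proof. by case/positiveE. Qed.

Lemma positive_ip T x : positive T -> 0 <= ip (T x) x.
Proof. by case/positiveE. Qed.

Lemma ip_adjoint T x y : ip (T x) y = ip x (adjoint T y).
Proof. by rewrite /ip adjointP. Qed.

Lemma positiveZ t T : 0 <= t -> positive T -> positive (t%:C *: T).
Proof. by move=> t0 T0 x; rewrite dotpZl mulr_ge0// ler0c. Qed.

(** Positivity of [T] at [x - N^-1 T x]. *)
Lemma positive_sqr_le T N : positive T -> 0 < N ->
  (forall x, ip (T x) x <= N * hnorm x ^+ 2) ->
  forall x, hnorm (T x) ^+ 2 <= N * ip (T x) x.
Proof.
move=> T0 N0 TN x; have := positive_ip (x + (- N^-1)%:C *: T x) T0.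
rewrite bop_funD bopZ !ipDl !ipDr !ipZl !ipZr (ip_adjoint _ (T x) x).
rewrite (positive_adjoint T0) ipxx => h.
have := TN (T x); set a := hnorm _ ^+ 2 in h *; set d := ip (T (T x)) _ in h *.
set e := ip _ _ in h *.
move=> dN; have Ni : 0 < N^-1 by rewrite invr_gt0.
rewrite -ler_pdivrMl//.
have : N^-1 ^+ 2 * d <= N^-1 ^+ 2 * (N * a) by rewrite ler_wpM2l ?exprn_ge0 ?(ltW Ni).
have -> : N^-1 ^+ 2 * (N * a) = N^-1 * a by field; rewrite gt_eqF.
by lra.
Qed.

(** By [positive_sqr_le], [|T x|^2 <= N <T x, x> <= N^2 |x|^2]. *)
Lemma bounded_by_form T N : positive T -> 0 < N ->
  (forall x, ip (T x) x <= N * hnorm x ^+ 2) -> bounded_by T N.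
Proof.
move=> T0 N0 TN x; rewrite -ler_sqr ?nnegrE ?hnorm_ge0 ?mulr_ge0 ?hnorm_ge0 ?(ltW N0)//.
rewrite (le_trans (positive_sqr_le T0 N0 TN x))// exprMn expr2 -mulrA.
by rewrite ler_wpM2l ?TN// ltW.
Qed.

(** A fixed point of [D |-> 1 + B D] in the ball of radius [1 / (1 - b)] is a right inverse. The
    adjoint of a right inverse of [1 - adjoint B] is a left inverse. *)
Lemma invertible_1B B b : 0 <= b < 1 -> bounded_by B b -> invertible (1 - B).
Proof.
have rinv C : 0 <= b < 1 -> bounded_by C b -> exists D, (1 - C) * D = 1.
  move=> /andP[b0 b1] Cb; have b1' : 0 < 1 - b by rewrite subr_gt0.
  have [|||D _ FD] := @fixpoint_exists R H (fun D => 1 + C * D) (1 - b)^-1 b.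
  - by rewrite invr_ge0 ltW.
  - by rewrite b0.
  - split=> [D Db|D D' N Db D'b N0 DD'].
      have -> : (1 - b)^-1 = 1 + b * (1 - b)^-1 by field; rewrite gt_eqF.
      by apply: bounded_byD; [apply: bounded_by1|apply: bounded_byM].
    by rewrite opprD addrACA subrr add0r -mulrBr; apply: bounded_byM.
  by exists D; rewrite mulrBl mul1r -{1}FD addrK.
move=> b01 Bb; have [D BD] := rinv _ b01 Bb.
have [E BE] := rinv _ b01 (bounded_by_adjoint Bb).
apply: (@invertible_lr (adjoint E) _ D) => //.
apply: (can_inj (@adjointK _ _)).
by rewrite adjointM adjointK adjointB adjoint1 BE.
Qed.

(** [sqrt (1 - B) = 1 - C] with [C = (B + C^2) / 2], a contraction of the ball of
    radius [(1 + b) / 2]. *)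
Lemma sqrt_1B B b : 0 <= b < 1 -> bounded_by B b -> adjoint B = B ->
  exists S, positive S /\ S * S = 1 - B.
Proof.
move=> /andP[b0 b1] Bb Bsa; pose h := (2^-1 : R)%:C.
pose r := (1 + b) / 2; have r0 : 0 <= r by rewrite /r; lra.
have r01 : 0 <= r < 1 by rewrite r0 /r; lra.
pose F C := h *: (B + C * C).
have h2 : `|2^-1 : R| = 2^-1 by rewrite ger0_norm.
have F_contracts : contracts F r r.
  split=> [C Cr|C D N Cr Dr N0 CD].
    (* The inequality [b + r^2 <= 2 r] amounts to [(1 - r)^2 <= 1 - b], where
       [1 - r = (1 - b) / 2]. *)
    apply: (@bounded_byW _ _ _ (`|2^-1| * (b + r * r))).
      by rewrite h2 /r; nra.
    by apply: bounded_byZ; apply: bounded_byD => //; apply: bounded_byM.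
  have -> : F C - F D = h *: (C * (C - D) + (C - D) * D).
    rewrite /F -scalerBr; congr (_ *: _).
    by rewrite mulrBr mulrBl opprD addrACA subrr add0r addrA subrK.
  apply: (@bounded_byW _ _ _ (`|2^-1| * (r * N + N * r))); first by rewrite h2; lra.
  by apply: bounded_byZ; apply: bounded_byD; apply: bounded_byM.
have [C Cr FC] := fixpoint_exists r0 r01 F_contracts.
(* As [B] is self-adjoint, [adjoint C] is a fixed point in the same ball, so uniqueness applies. *)
have Csa : adjoint C = C.
  apply: (fixpoint_unique r0 r01 F_contracts) => //.
    exact: bounded_by_adjoint.
  by rewrite -{2}FC /F adjointZ adjointD adjointM Bsa.
have CC : C + C = B + C * C.
  have hh : h + h = 1 by rewrite /h -rmorphD -(rmorph1 (real_complex R)); congr (_%:C); field.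
  by rewrite -{1 2}FC /F -scalerDl hh scale1r.
exists (1 - C); split; last first.
  have -> : B = C + C - C * C by rewrite CC addrK.
  rewrite mulrBl mul1r mulrBr mulr1 !opprB -addrA; congr (1 + _).
  by rewrite addrCA opprD.
apply/positiveE; split.
  by rewrite adjointB adjoint1 Csa.
move=> x /=; rewrite scaleN1r ipDl ipNl ipxx.
have := ip_le (C x) x; have := Cr x; have := hnorm_ge0 x; move: r01 => /andP[_ r1].
by nra.
Qed.

(** Scaling by an upper bound [M] turns [P] into [1 - B] with [B] positive, and invertibility of [P]
    keeps the norm of [B] strictly below [1]; then [sqrt_1B] applies. *)
Lemma sqrt_exists P : positive P -> invertible P ->
  exists S, positive S /\ S * S = P.
Proof.
move=> P0 [Q [QP PQ]].
have [M M0 PM] := bop_bound P; have [N N0 QN] := bop_bound Q.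
have form_le x : ip (P x) x <= M * hnorm x ^+ 2.
  by rewrite (le_trans (ip_le _ _))// expr2 mulrA ler_wpM2r ?hnorm_ge0.
pose c := (N ^+ 2 * M)^-1; have c0 : 0 < c by rewrite invr_gt0 mulr_gt0 ?exprn_gt0.
(* The inverse [Q] gives [|x|^2 <= N^2 |P x|^2], and [positive_sqr_le] bounds this by
   [N^2 M <P x, x>]. *)
have form_ge x : c * hnorm x ^+ 2 <= ip (P x) x.
  rewrite mulrC ler_pdivrMr ?mulr_gt0 ?exprn_gt0//.
  have : hnorm x ^+ 2 <= (N * hnorm (P x)) ^+ 2.
    rewrite ler_sqr ?nnegrE ?mulr_ge0 ?hnorm_ge0 ?(ltW N0)//.
    by have := QN (P x); rewrite -[Q (P x)]/((Q * P) x) QP.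
  move=> /le_trans; apply; rewrite exprMn.
  have -> : ip (P x) x * (N ^+ 2 * M) = N ^+ 2 * (M * ip (P x) x) by ring.
  by rewrite ler_wpM2l ?exprn_ge0 ?(ltW N0)//; apply: positive_sqr_le.
pose B := 1 - (M^-1)%:C *: P.
have Bform x : ip (B x) x = hnorm x ^+ 2 - M^-1 * ip (P x) x.
  by rewrite /= scaleN1r ipDl ipNl ipZl ipxx.
have B0 : positive B.
  apply/positiveE; split.
    by rewrite adjointB adjoint1 adjointZ positive_adjoint.
  by move=> x; rewrite Bform subr_ge0 mulrC ler_pdivrMr// mulrC.
(* The maximum with [1/2] keeps [b] positive, as [bounded_by_form] requires; [1 - c / M] alone could
   vanish. *)
pose b := Num.max (1 - M^-1 * c) 2^-1.
have b0 : 0 < b by rewrite lt_max invr_gt0 ltr0n orbT.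
have b1 : b < 1.
  rewrite gt_max; apply/andP; split; last by rewrite invf_lt1 ?ltr0n ?ltr1n.
  by rewrite ltrBlDr ltrDl; apply: mulr_gt0 => //; rewrite invr_gt0.
have Bb : bounded_by B b.
  apply: bounded_by_form => // x; rewrite Bform.
  apply: (@le_trans _ _ ((1 - M^-1 * c) * hnorm x ^+ 2)).
    by rewrite mulrBl mul1r lerD2l lerN2 -mulrA ler_wpM2l// invr_ge0 ltW.
  by rewrite ler_wpM2r ?exprn_ge0 ?hnorm_ge0// le_max lexx.
have [|S [S0 SS]] := sqrt_1B _ Bb (positive_adjoint B0); first by rewrite ltW.
exists ((Num.sqrt M)%:C *: S); split; first by apply: positiveZ => //; rewrite sqrtr_ge0.
rewrite -bop_scaleAl -bop_scaleAr scalerA -rmorphM -expr2 sqr_sqrtr ?ltW// SS.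
by rewrite opprB addrC subrK scalerA -rmorphM/= mulfV ?gt_eqF// scale1r.
Qed.

Lemma op_sqrtP P : positive P -> invertible P ->
  [/\ adjoint (op_sqrt P) = op_sqrt P, op_sqrt P * op_sqrt P = P
    & invertible (op_sqrt P)].
Proof.
move=> P0 Pinv; have [S SP] := sqrt_exists P0 Pinv.
have [/positive_adjoint Q0 QP] : positive (op_sqrt P) /\ op_sqrt P * op_sqrt P = P.
  by rewrite /op_sqrt; case: xgetP => [//|none]; have := none S SP.
split=> //; apply: (@invertible_lr (op_inv P * op_sqrt P) _ (op_sqrt P * op_inv P)).
  by rewrite -mulrA QP op_invl.
by rewrite mulrA QP op_invr.
Qed.

End PositiveOperators.

(** * Conjugations, completely positive maps and summands of extreme points *)

Section CompletelyPositiveMaps.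
Local Open Scope complex_scope.
Variables (R : realType) (A : cstarAlgType R) (H : hilbertType R).
Implicit Types (Phi Psi E L : A -> bop H) (P S T X Y : bop H) (t : R).

Lemma AdM S T X : Ad S (Ad T X) = Ad (T * S) X.
Proof. by rewrite /Ad adjointM !mulrA. Qed.

Lemma Ad_1 X : Ad 1 X = X.
Proof. by rewrite /Ad adjoint1 mul1r mulr1. Qed.

Lemma Ad_inv T X : invertible T -> Ad T (Ad (op_inv T) X) = X.
Proof. by move=> Ti; rewrite AdM op_invl// Ad_1. Qed.

Lemma Ad_invV T X : invertible T -> Ad (op_inv T) (Ad T X) = X.
Proof. by move=> Ti; rewrite AdM op_invr// Ad_1. Qed.

Lemma AdD T X Y : Ad T (X + Y) = Ad T X + Ad T Y.
Proof. by rewrite /Ad mulrDr mulrDl. Qed.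

Lemma AdB T X Y : Ad T (X - Y) = Ad T X - Ad T Y.
Proof. by rewrite /Ad mulrBr mulrBl. Qed.

Lemma AdZ T k X : Ad T (k *: X) = k *: Ad T X.
Proof. by rewrite /Ad bop_scaleAl -bop_scaleAr. Qed.

Lemma Ad_sum T n (X : 'I_n -> bop H) : Ad T (\sum_j X j) = \sum_j Ad T (X j).
Proof.
elim/big_rec2: _ => [|i u v _ <-]; last by rewrite AdD.
by rewrite /Ad mulr0 mul0r.
Qed.

Lemma Ad_sqrt t T X : 0 <= t -> Ad ((Num.sqrt t)%:C *: T) X = t%:C *: Ad T X.
Proof.
move=> t0; rewrite /Ad adjointZ -!bop_scaleAl -bop_scaleAr scalerA -rmorphM.
by rewrite -expr2 sqr_sqrtr.
Qed.

Lemma invertible_Ad T X : invertible T -> invertible X -> invertible (Ad T X).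
Proof.
by move=> Ti Xi; apply: invertibleM (invertibleM (invertible_adjoint Ti) Xi) Ti.
Qed.

Lemma bop_fun_sum T I (r : seq I) (f : I -> H) :
  T (\sum_(i <- r) f i) = \sum_(i <- r) T (f i).
Proof. by elim/big_rec2: _ => [|i u v _ <-]; rewrite ?bop0 ?bop_funD. Qed.

(** Moving [adjoint T] across the form leaves the positivity of [Phi] tested on the vectors
    [T (x i)]. *)
Lemma cp_Ad T Phi : completely_positive Phi -> completely_positive (Ad T \o Phi).
Proof.
move=> [Pl Pp]; split=> [k a b /=|n X X0 x]; first by rewrite Pl AdD AdZ.
have := Pp n X X0 (fun i => T (x i)); congr (0 <= _); apply: eq_bigr => i _.
by rewrite adjointPr bop_fun_sum.
Qed.

Lemma cpD Phi Psi : completely_positive Phi -> completely_positive Psi ->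
  completely_positive (fun a => Phi a + Psi a).
Proof.
move=> [Pl Pp] [Ql Qp]; split=> [k a b /=|n X X0 x].
  by rewrite Pl Ql scalerDr addrACA.
have := addr_ge0 (Pp n X X0 x) (Qp n X X0 x); rewrite -big_split /=.
by congr (0 <= _); apply: eq_bigr => i _; rewrite -dotpDl -big_split.
Qed.

Lemma cpZ t Phi : 0 <= t -> completely_positive Phi ->
  completely_positive (fun a => t%:C *: Phi a).
Proof.
move=> t0 Phi_cp; have := cp_Ad ((Num.sqrt t)%:C *: (1 : bop H)) Phi_cp.
by congr completely_positive; apply/funext => a /=; rewrite Ad_sqrt// Ad_1.
Qed.

Lemma cp0 : completely_positive (fun _ : A => 0 : bop H).
Proof.
split=> [k a b|n X _ x]; first by rewrite scaler0 addr0.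
by rewrite big1// => i _; rewrite big1 ?dotp0l.
Qed.

Lemma cp_sum I (r : seq I) (p : pred I) (F : I -> A -> bop H) :
    (forall i, completely_positive (F i)) ->
  completely_positive (fun a => \sum_(i <- r | p i) F i a).
Proof.
move=> Fcp; elim: r => [|i r IH].
  by rewrite (_ : (fun _ => _) = fun=> 0)//; [apply: cp0|apply/funext => a; rewrite big_nil].
have := cpD (Fcp i) IH; case: (boolP (p i)) => pi.
  by move=> h; congr completely_positive: h; apply/funext => a; rewrite big_cons pi.
by move=> _; congr completely_positive: IH; apply/funext => a; rewrite big_cons (negbTE pi).
Qed.

Lemma star1 : star (1 : A) = 1.
Proof.
by have := starM (star (1 : A)) 1; rewrite starK [cstar_mul _ _]mulr1 starK => <-.
Qed.

(** Apply complete positivity to the 1 x 1 matrix with entry [1 = star 1 * 1]. *)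
Lemma cp_positive1 Phi : completely_positive Phi -> positive (Phi 1).
Proof.
move=> [_ Pp] x; have := Pp 1%N (const_mx 1) _ (fun=> x).
rewrite !big_ord1 mxE; apply; exists (const_mx 1).
by apply/matrixP => i j; rewrite !mxE big_ord1 !mxE star1 mulr1.
Qed.

Lemma cp_le_Ad T Psi Phi : cp_le Psi Phi -> cp_le (Ad T \o Psi) (Ad T \o Phi).
Proof.
move=> /(cp_Ad T) h; congr completely_positive: h; apply/funext => a /=.
exact: AdB.
Qed.

Lemma CP_Ad T P Phi : CP P Phi -> CP (Ad T P) (Ad T \o Phi).
Proof. by move=> [Phi_cp Phi1]; split; [apply: cp_Ad|rewrite /= Phi1]. Qed.

(** The decomposition [E = Ad S1 (Ad S1^-1 L1) + Ad S2 (Ad S2^-1 L2)], with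
    [Sj] the square root of [Lj 1], is a C*-convex combination. *)
Lemma Cstar_extreme_summand E L1 L2 : Cstar_extreme E ->
    completely_positive L1 -> completely_positive L2 ->
    invertible (L1 1) -> invertible (L2 1) ->
    (forall a, E a = L1 a + L2 a) ->
  exists Z, invertible Z /\ L1 = Ad Z \o E.
Proof.
move=> [[_ E1] Eext] L1cp L2cp L1i L2i EL.
have [sa1 sq1 inv1] := op_sqrtP (cp_positive1 L1cp) L1i.
have [sa2 sq2 inv2] := op_sqrtP (cp_positive1 L2cp) L2i.
set S1 := op_sqrt _ in sa1 sq1 inv1; set S2 := op_sqrt _ in sa2 sq2 inv2.
have ucp S L : completely_positive L -> invertible S -> adjoint S = S ->
    S * S = L 1 -> UCP (Ad (op_inv S) \o L).
  move=> Lcp Si Ssa SS; split; first exact: cp_Ad.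
  have SE : Ad S 1 = L 1 by rewrite /Ad Ssa mulr1.
  by rewrite /= -SE Ad_invV.
pose Phi_ (j : 'I_2) := if j == ord0 then Ad (op_inv S1) \o L1 else Ad (op_inv S2) \o L2.
pose T (j : 'I_2) := if j == ord0 then S1 else S2.
have [||||U [[UU UU'] L1E]] := Eext 2%N Phi_ T isT _ _ _ _ ord0.
- by rewrite /Phi_ => j; case: ifP => _; apply: ucp.
- by rewrite /T => j; case: ifP.
- by rewrite big_ord_recl big_ord1 /T /= sa1 sa2 sq1 sq2 -EL.
- by move=> a; rewrite big_ord_recl big_ord1 /T /Phi_ /= !Ad_inv.
exists (U * S1); split.
  by apply: invertibleM => //; exists (adjoint U).
apply/funext => a /=; rewrite -AdM; have /(congr1 (fun f => f a)) := L1E.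
by rewrite /Phi_ /= => <-; rewrite Ad_inv.
Qed.

(** [E = Psi / 2 + (E - Psi / 2)], where [1 - Psi 1 / 2] is invertible because
    [0 <= Psi 1 <= 1]. *)
Lemma Cstar_extreme_cp_le E Psi : Cstar_extreme E ->
    completely_positive Psi -> cp_le Psi E -> invertible (Psi 1) ->
  exists Z, invertible Z /\ Psi = Ad Z \o E.
Proof.
move=> Eext Psi_cp Psi_le Psi_inv.
have h0 : 0 <= 2^-1 :> R by rewrite invr_ge0.
pose h : R[i] := (2^-1 : R)%:C.
have hh : h + h = 1 by rewrite /h -rmorphD -(rmorph1 (real_complex R)); congr (_%:C); field.
have E1 : E 1 = 1 by case: Eext => [[]].
have Psi1_le x : ip (Psi 1 x) x <= 1 * hnorm x ^+ 2.
  have := positive_ip x (cp_positive1 Psi_le).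
  by rewrite E1 /= scaleN1r ipDl ipNl ipxx mul1r subr_ge0.
have Psi1_bound := bounded_by_form (cp_positive1 Psi_cp) ltr01 Psi1_le.
have [||||Z [Zi PsiZ]] := @Cstar_extreme_summand E (fun a => h *: Psi a)
    (fun a => (E a - Psi a) + h *: Psi a) Eext (cpZ h0 Psi_cp).
- exact: cpD Psi_le (cpZ h0 Psi_cp).
- by apply: invertibleZ => //; rewrite invr_eq0.
- have -> : E 1 - Psi 1 + h *: Psi 1 = 1 - h *: Psi 1.
    by rewrite E1 -{1}(scale1r (Psi 1)) -hh scalerDl opprD addrA subrK.
  apply: (@invertible_1B _ _ _ (`|2^-1| * 1)); last exact: bounded_byZ.
  by rewrite ger0_norm// mulr1 h0 invf_lt1 ?ltr1n.
- by move=> a; rewrite addrC -addrA -scalerDl hh scale1r subrK.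
(* The factor [sqrt 2] undoes the halving of [Psi]. *)
exists ((Num.sqrt 2)%:C *: Z); split.
  by apply: invertibleZ => //; rewrite sqrtr_eq0 -ltNge.
apply/funext => a; have /(congr1 (fun f => f a))/= := PsiZ.
rewrite /= Ad_sqrt// => <-; rewrite scalerA -rmorphM.
by rewrite divff// scale1r.
Qed.

End CompletelyPositiveMaps.

(** * The cycle (i) => (ii) => (iii) => (iv) => (i) *)

Theorem theorem3p19 (R : realType) (A : cstarAlgType R) (H : hilbertType R)
    (P : bop H) (P_positive : positive P) (P_invertible : invertible P)
    (Phi : A -> bop H) (PhiP : CP P Phi) :
  [<-> P_Cstar_extreme P Phi ;
       Cstar_extreme (hat P Phi) ;
       exists (Psi : A -> bop H) (T : bop H),
         [/\ Cstar_extreme Psi, invertible T, adjoint T * T = P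
           & Phi = Ad T \o Psi] ;
       forall Psi : A -> bop H,
         completely_positive Psi -> cp_le Psi Phi -> invertible (Psi 1) ->
         exists Z : bop H, invertible Z /\ Psi = Ad Z \o Phi ].
Proof.
have [Ssa SS Sinv] := op_sqrtP P_positive P_invertible.
set S := op_sqrt P in Ssa SS Sinv; pose V := op_inv S.
have Vinv : invertible V := invertible_inv Sinv.
have VS : V * S = 1 := op_invl Sinv.
have SV : S * V = 1 := op_invr Sinv.
have Vsa : adjoint V = V.
  by rewrite -[LHS]mulr1 -SV mulrA -{1}Ssa -adjointM SV adjoint1 mul1r.
have PE : Ad S 1 = P by rewrite /Ad Ssa mulr1.
have hatE : hat P Phi = Ad V \o Phi by apply/funext => a; rewrite /= /Ad Vsa.
tfae.
- move=> [_ Phi_ext]; split.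
    by rewrite hatE; have := CP_Ad V PhiP; rewrite -PE Ad_invV.
  move=> n Phi_ T n0 Phi_ucp Tinv T1 hat_sum j.
  (* Conjugating by [S] carries a combination for [hat P Phi] to one for [Phi]. The coefficient
     [V * T j * S] cancels the [S] in [Ad S \o Phi_ j], and [V P V = 1] turns the unital
     normalisation into the one for [P]. *)
  have [||||Z [Zinv PhiZ]] := Phi_ext n (fun j => Ad S \o Phi_ j)
    (fun j => V * T j * S) n0 _ _ _ _ j.
  - by move=> i; rewrite -PE; apply: CP_Ad; apply: Phi_ucp.
  - by move=> i; apply: invertibleM (invertibleM Vinv (Tinv i)) Sinv.
  - rewrite -[RHS]PE -T1 Ad_sum; apply: eq_bigr => i _.
    by rewrite -[LHS]/(Ad _ P) -PE AdM mulrA mulrA SV mul1r -AdM /Ad mulr1.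
  - move=> a; rewrite -[LHS](Ad_inv _ Sinv) -[Ad _ (Phi a)]/((Ad V \o Phi) a) -hatE.
    rewrite hat_sum Ad_sum; apply: eq_bigr => i _.
    by rewrite /= !AdM !mulrA SV mul1r.
  have Phi_E : Phi_ j = Ad (S * Z * V) \o hat P Phi.
    apply/funext => a; rewrite -(Ad_invV (Phi_ j a) Sinv).
    rewrite -[Ad S _]/((Ad S \o Phi_ j) a) PhiZ hatE /= !AdM.
    by rewrite !mulrA VS mul1r.
  have Uinv := invertibleM (invertibleM Sinv Zinv) Vinv.
  exists (S * Z * V); split=> //.
  (* Both [Phi_ j] and [hat P Phi] are unital, so evaluate [Phi_E] at [1]. *)
  have UU : adjoint (S * Z * V) * (S * Z * V) = 1.
    have [_ Phi_1] := Phi_ucp j; rewrite -[RHS]Phi_1 Phi_E hatE /=.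
    by rewrite PhiP.2 -PE Ad_invV// /Ad mulr1.
  split=> //; have [W [WU UW]] := Uinv.
  suff -> : adjoint (S * Z * V) = W by [].
  by rewrite -[LHS]mulr1 -UW mulrA UU mul1r.
- move=> hat_ext; exists (hat P Phi), S; split=> //; first by rewrite Ssa.
  by apply/funext => a; rewrite hatE /= Ad_inv.
- move=> [E [T [E_ext Tinv _ PhiE]]] Psi Psi_cp Psi_le Psi_inv.
  have Winv := invertible_inv Tinv.
  (* Conjugation by the inverse of [T] preserves the order and replaces [Phi] by the unital map
     [E]. *)
  have EPhi : E = Ad (op_inv T) \o Phi.
    by apply/funext => a; rewrite PhiE /= Ad_invV.
  have [|||Z [Zinv PsiZ]] := @Cstar_extreme_cp_le _ _ _ E (Ad (op_inv T) \o Psi) E_ext.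
  - exact: cp_Ad.
  - by rewrite EPhi; apply: cp_le_Ad.
  - exact: invertible_Ad.
  exists (op_inv T * (Z * T)); split; first exact: invertibleM Winv (invertibleM Zinv Tinv).
  apply/funext => a; rewrite -[LHS](Ad_inv _ Tinv).
  rewrite -[Ad (op_inv T) (Psi a)]/((Ad (op_inv T) \o Psi) a).
  by rewrite PsiZ EPhi /= !AdM mulrA.
- move=> Phi_max; split=> // n Phi_ T _ Phi_cp Tinv _ Phi_sum j.
  have [|||Z [Zinv PhiZ]] := Phi_max (Ad (T j) \o Phi_ j).
  - by apply: cp_Ad; case: (Phi_cp j).
  (* The difference [Phi - Ad (T j) \o Phi_ j] is the sum of the other terms, hence completely
     positive. *)
  - have := @cp_sum _ A H _ (index_enum 'I_n) (fun i => i != j) (fun i => Ad (T i) \o Phi_ i)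
      (fun i => cp_Ad (T i) (Phi_cp i).1).
    congr completely_positive; apply/funext => a.
    by rewrite Phi_sum [in RHS](bigD1 j)//= [RHS]addrC addKr.
  - by rewrite /= (Phi_cp j).2; apply: invertible_Ad.
  exists (Z * op_inv (T j)); split; first by apply: invertibleM (invertible_inv _).
  apply/funext => a; rewrite -[LHS](Ad_invV _ (Tinv j)) -[Ad (T j) _]/((Ad (T j) \o Phi_ j) a).
  by rewrite PhiZ /= AdM.
Qed.
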